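(* Let $K$ be a quadratically closed field of characteristic zero, let $d$ be a nonzero integer, and suppose $K$ is closed under $d$-roots. Let $M_2(K)$ be endowed with the Vasilovsky $\mathbb{Z}_2$-grading. Let $f\in K\langle X|\mathbb{Z}_2\rangle$ be a semi-homogeneous $\mathbb{Z}_2$-graded polynomial of weighted degree $d$. Then the image of $f$ evaluated on the algebra $M_2(K)$ of $2\times 2$ matrices over $K$ is one of the following: $\{0\}$, $K$ (the set of scalar matrices), $sl_2(K)_0$ (the set of trace zero diagonal matrices), $M_2(K)_0$, $M_2(K)_1$, $D_0$, or $D_1$, where $D_i$ denotes a subset of $M_2(K)_i$ that is dense in the Zariski topology of $M_2(K)_i$ ($i=0,1$).
   Context: Vasilovsky (canonical) $\mathbb{Z}_2$-grading on $M_2(K)$: $M_2(K)=M_2(K)_0\oplus M_2(K)_1$, where $M_2(K)_0$ is the set of diagonal matrices and $M_2(K)_1$ is the span of the matrix units $E_{1,2},E_{2,1}$. Graded polynomials: $X=X_0\cup X_1$ is a disjoint union of two countable sets of noncommuting variables, and $K\langle X|\mathbb{Z}_2\rangle$ is the free associative unital $K$-algebra on $X$. A variable $x\in X_g$ has $\mathbb{Z}_2$-degree $\deg(x)=g$. The elements of $K\langle X|\mathbb{Z}_2\rangle$ are called $\mathbb{Z}_2$-graded polynomials. Image: if $g_i=\deg(x_i)$, the image of $f(x_1,\dots,x_m)$ on $M_2(K)$ is $\{f(a_1,\dots,a_m) : a_i\in M_2(K)_{g_i},\ i=1,\dots,m\}$. Semi-homogeneous: $f(x_1,\dots,x_m)$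 is semi-homogeneous of weighted degree $d\neq 0$ if there are integer weights $w_1,\dots,w_m$ such that for every monomial occurring in $f$, if $d_i$ is the number of occurrences of $x_i$ in that monomial, then $w_1d_1+\cdots+w_md_m=d$. $K$ is closed under $d$-roots if every element of $K$ has a $d$-th root in $K$ (for negative $d$, a $|d|$-th root). $K$ is quadratically closed if every polynomial of degree $2$ over $K$ has a root in $K$. The Zariski topology on a $k$-dimensional $K$-vector space $V\cong K^k$ is the one whose closed sets are the common zero sets in $K^k$ of sets of polynomials in $K[x_1,\dots,x_k]$.
   Formalization: The formal theorem also assumes f is homogeneous for the Z_2-grading of K<X|Z_2>; without this the claim is false: f = x + y with deg x = 0, deg y = 1, weights 1, 1, d = 1 has image all of M_2(K), which is not in the list. *)

(* Defs.v *)
From HB Require Import structures.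
From mathcomp Require Import all_boot all_order all_algebra.
From mathcomp Require Import finmap.
From mathcomp Require Import boolp classical_sets.
From mathcomp.multinomials Require Import monalg.
From mathcomp.multinomials Require mpoly.

Set Implicit Arguments.
Unset Strict Implicit.
Unset Printing Implicit Defensive.

Import GRing.Theory.
Local Open Scope ring_scope.
Local Open Scope classical_set_scope.

Definition quadratically_closed (K : fieldType) : Prop :=
  forall p : {poly K}, size p = 3%N -> exists x : K, root p x.

Definition closed_under_roots (K : fieldType) (d : int) : Prop :=
  forall x : K, exists y : K, y ^+ `|d|%N = x.

(* The variable (g, i) is the i-th variable of degree g. *)
Notation gvar := ('Z_2 * nat)%type.

Definition gdeg (x : gvar) : 'Z_2 := x.1.

(* The free associative unital algebra: the algebra of the free monoid. *)
Notation gpoly K := {malg K[{fmonom gvar}]}.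

(* The integer weights of variables that do not occur in f are immaterial, so
   they are given on all of X; d_i is the multiplicity of x_i in a word. *)
Definition semi_homogeneous (K : fieldType) (d : int) (f : gpoly K) : Prop :=
  exists w : gvar -> int, forall m : {fmonom gvar}, m \in msupp f ->
    \sum_(x <- undup m) w x * (count_mem x m)%:Z = d.

(* f lies in one homogeneous component of the Z_2-graded free algebra.
   Semi-homogeneity does not imply this: x + y with gdeg x = 0 and gdeg y = 1
   is semi-homogeneous of weighted degree 1, and its image is all of M_2(K). *)
Definition graded_homogeneous (K : fieldType) (f : gpoly K) : Prop :=
  exists g : 'Z_2, forall m : {fmonom gvar}, m \in msupp f ->
    \sum_(x <- fmonom_val m) gdeg x = g.

Definition M2_component (K : fieldType) (g : 'Z_2) : {vspace 'M[K]_2} :=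
  if g == 0 then <<[:: delta_mx 0 0; delta_mx 1 1]%R>>%VS
  else <<[:: delta_mx 0 1; delta_mx 1 0]%R>>%VS.

Lemma mem_M2_component0 (K : fieldType) (A : 'M[K]_2) :
  (A \in M2_component K 0%R) = is_diag_mx A.
Proof.
rewrite /M2_component eqxx span_cons span_seq1.
apply/idP/is_diag_mxP => [/memv_addP[_ /vlineP[a ->] [_ /vlineP[b ->] ->]]|dA].
  move=> i j; rewrite !mxE.
  by case: i j => [[|[|//]] ?] [[|[|//]] ?] //= _; rewrite !mulr0 addr0.
have -> : A = A 0 0 *: delta_mx 0 0 + A 1 1 *: delta_mx 1 1.
  apply/matrixP => i j; rewrite !mxE.
  case: (eqVneq i j) => [<-|ij].
    have [->|->] : i = 0 \/ i = 1.
      by case: i => [[|[|//]] ?]; [left|right]; apply/val_inj.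
    - by rewrite !mulr1 mulr0 addr0.
    - by rewrite !mulr1 mulr0 add0r.
  rewrite dA //; case: i j ij => [[|[|//]] ?] [[|[|//]] ?] //= _;
    by rewrite !mulr0 addr0.
by rewrite memv_add // memvZ // memv_line.
Qed.

Definition gpoly_eval (K : fieldType) (a : gvar -> 'M[K]_2) (f : gpoly K) :
    'M[K]_2 :=
  mmap (@scalar_mx K 2) (fun m : {fmonom gvar} => \prod_(x <- fmonom_val m) a x) f.

Definition gpoly_image (K : fieldType) (f : gpoly K) : set 'M[K]_2 :=
  [set gpoly_eval a f | a in
     [set a | forall x : gvar, a x \in M2_component K (gdeg x)]].

(* The topology does not depend on the basis used to identify U with K^k: a
   linear change of coordinates preserves the class of common zero sets. *)
Definition zariski_closed (K : fieldType) (V : vectType K) (U : {vspace V})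
    (C : set V) : Prop :=
  exists P : set (mpoly.mpoly (\dim U) K),
    C = [set v | v \in U /\
           forall p, P p -> mpoly.meval (fun i => coord (vbasis U) i v) p = 0].

Definition zariski_dense (K : fieldType) (V : vectType K) (U : {vspace V})
    (D : set V) : Prop :=
  D `<=` [set` U] /\
  forall C : set V, zariski_closed U C -> D `<=` C -> [set` U] `<=` C.

(* Main.v *)
Require Import Defs.
From mathcomp Require Import all_boot all_order all_algebra.
From mathcomp Require Import finmap.
From mathcomp Require Import boolp classical_sets.
From mathcomp.multinomials Require Import monalg.
From mathcomp.multinomials Require mpoly.
From mathcomp Require Import ring.

(** The image of [f] is a cone: replacing each variable [x] by
[c ^ w x *: x] multiplies the value of [f] by [c ^ d], and every nonzero scalar
is such a power. It contains [0] because a constant term would have weight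
[0 <> d]. It is also stable under the conjugations that preserve the grading,
by the swap of the two basis vectors and by diagonal matrices. It lies in one
of the two planes [M2_component K g], since [f] is homogeneous.

Odd case. A value has entries [p], [q] off the diagonal, and conjugation by
[diag(c, 1)] turns them into [c p], [q / c]. Together with the cone property and
square roots in [K], this makes the image stable under independent rescalings
of [p] and [q]. The swap exchanges [p] and [q], so if [f] has a nonzero value
then neither entry vanishes identically, and over an infinite field some value
has both entries nonzero. The image then contains every [(p, q)] with
[p q <> 0], hence is dense.

Even case. If any two values are proportional, the image is [0] or a line; the
swap preserves this line, so it is spanned by [(1, 1)] or by [(1, -1)], that is,
it consists of the scalar matrices or of the trace zero diagonal ones. If two
values are independent, the direction of [f(a)] avoids any prescribed finite set
of directions for some [a], so the image contains infinitely many lines through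
the origin. A line that misses the origin meets almost all of them.

Both density claims end with [zariski_dense_of_lines]: a subset of a plane is
dense when each point lies on a line that meets the subset infinitely often.
The existence of values in general position is [common_nonvanishing]. It
needs no polynomials in several variables: polynomiality along affine lines of
the space of arguments ([polynomial_on_lines]) is enough. *)

Set Implicit Arguments.
Unset Strict Implicit.
Unset Printing Implicit Defensive.

Import GRing.Theory.
Local Open Scope ring_scope.
Local Open Scope classical_set_scope.

(** * Polynomials over an infinite field and Zariski density *)

(** Characteristic zero enters only here, to make [K] infinite. *)
Lemma exists_notin (K : fieldType) (char0 : [pchar K] =i pred0) (cs : seq K) :
  exists t, t \notin cs.
Proof.
(* If all the integers [n%:R] with [n < size p] were in [cs], this [p] would have
   too many roots. *)
pose p := \prod_(c <- cs) ('X - c%:P).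
have p_neq0 : p != 0 by rewrite monic_neq0 ?monic_prod_XsubC.
pose rs := [seq n%:R : K | n <- iota 0 (size p)].
have uniq_rs : uniq rs.
  rewrite map_inj_uniq ?iota_uniq // => m n /eqP.
  wlog le_mn : m n / (m <= n)%N.
    move=> le_inj eq_mn; case/orP: (leq_total m n) => le_mn; first exact: le_inj.
    by apply/esym/le_inj => //; rewrite eq_sym.
  rewrite -(subnKC le_mn) natrD -subr_eq0 opprD addNKr oppr_eq0.
  by rewrite ((pcharf0P K).1 char0) => /eqP ->; rewrite addn0.
case: (boolP (all (root p) rs)) => [all_rs|/allPn[t _]].
  by have := max_poly_roots p_neq0 all_rs uniq_rs; rewrite size_map size_iota ltnn.
by rewrite root_prod_XsubC; exists t.
Qed.

Lemma poly_eq0_of_many_roots (K : fieldType) (p : {poly K}) (R : set K) :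
    (forall t, R t -> root p t) -> (forall cs : seq K, exists2 t, t \notin cs & R t) ->
  p = 0.
Proof.
move=> rootR infR; apply/eqP/negPn/negP => p_neq0.
have [cs [uniq_cs size_cs root_cs]] :
    exists cs : seq K, [/\ uniq cs, size cs = size p & all (root p) cs].
  elim: (size p) => [|n [cs [uniq_cs <- root_cs]]]; first by exists [::].
  have [t t_cs Rt] := infR cs.
  by exists (t :: cs); split; rewrite //= ?t_cs ?rootR.
by have := max_poly_roots p_neq0 root_cs uniq_cs; rewrite size_cs ltnn.
Qed.

Lemma exists_nonroot (K : fieldType) (char0 : [pchar K] =i pred0) (p : {poly K}) :
  p != 0 -> exists t, p.[t] != 0.
Proof.
move=> p_neq0; apply: contrapT => no_t; move/eqP: p_neq0; apply.
apply: (@poly_eq0_of_many_roots _ _ setT) => [t _|cs].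
  by apply/rootP/eqP/negPn/negP => pt; apply: no_t; exists t.
by have [t tcs] := exists_notin char0 cs; exists t.
Qed.

(** A polynomial that vanishes on [D] restricts to a one-variable polynomial on
the line through [v], and that polynomial has infinitely many roots; so it is
zero, and in particular it vanishes at [v]. *)
Lemma zariski_dense_of_lines (K : fieldType) (V : vectType K) (U : {vspace V})
    (D : set V) :
    D `<=` [set` U] ->
    (forall v, v \in U -> exists w, forall cs : seq K,
       exists2 t, t \notin cs & D (v + t *: w)) ->
  zariski_dense U D.
Proof.
move=> DU lines; split=> // C [P ->] DP v Uv; split=> // p Pp.
have [w line_w] := lines v Uv.
pose r : {poly K} := \sum_(m <- mpoly.msupp p) (mpoly.mcoeff m p)%:P *
  \prod_i ((coord (vbasis U) i v)%:P + 'X * (coord (vbasis U) i w)%:P)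
    ^+ (mpoly.fun_of_multinom m i).
have rE t : r.[t] = mpoly.meval (fun i => coord (vbasis U) i (v + t *: w)) p.
  rewrite mpoly.mevalE horner_sum; apply: eq_bigr => m _.
  rewrite hornerM hornerC horner_prod; congr (_ * _); apply: eq_bigr => i _.
  rewrite horner_exp hornerD hornerM !hornerC hornerX linearD linearZ /=.
  by [].
have r0 : r = 0.
  apply: poly_eq0_of_many_roots line_w => t Dt.
  by apply/rootP; rewrite rE; have [_ ->] := DP _ Dt.
by have := rE 0; rewrite r0 horner0 scale0r addr0.
Qed.

(** * The two components of the grading in coordinates *)

(** Rows and columns are indexed by [Z_2] itself, so that [delta_mx i j] has
degree [j - i]; this treats both components at once. *)
Lemma mem_M2_component (K : fieldType) (g : 'Z_2) (A : 'M[K]_2) :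
  reflect (forall i j : 'Z_2, j != i + g -> A i j = 0) (A \in M2_component K g).
Proof.
have Z2P (i : 'Z_2) : i = 0 \/ i = 1.
  by case: i => [[|[|//]] ?]; [left|right]; apply/val_inj.
have -> : M2_component K g = <<[:: delta_mx 0 g; delta_mx 1 (1 + g)]%R>>%VS.
  rewrite /M2_component; case: (Z2P g) => ->; first by rewrite addr0.
  by have -> : 1 + 1 = 0 :> 'Z_2 by apply/val_inj.
rewrite span_cons span_seq1; apply: (iffP idP).
  case/memv_addP => [_ /vlineP[a ->] [_ /vlineP[b ->] ->]] i j.
  by rewrite !mxE; case: (Z2P i) => ->; case: (Z2P j) => ->; case: (Z2P g) => -> //=;
    rewrite ?mulr0 ?addr0.
move=> A0; have -> : A = A 0 g *: delta_mx 0 g + A 1 (1 + g) *: delta_mx 1 (1 + g).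
  apply/matrixP => i j; rewrite !mxE.
  have [->|neq_j] := eqVneq j (i + g); last rewrite A0 //.
    by case: (Z2P i) => ->; rewrite ?add0r !eqxx /= ?mulr0 ?mulr1 ?addr0 ?add0r.
  by move: neq_j; case: (Z2P i) => ->; rewrite ?add0r => /negPf -> /=; rewrite !mulr0 addr0.
by rewrite memv_add // memvZ // memv_line.
Qed.

Lemma M2_component_mul (K : fieldType) (g h : 'Z_2) (A B : 'M[K]_2) :
  A \in M2_component K g -> B \in M2_component K h -> A * B \in M2_component K (g + h).
Proof.
move=> /mem_M2_component A0 /mem_M2_component B0; apply/mem_M2_component => i j neq_j.
rewrite mxE big1 // => k _; have [eq_k|/A0 ->] := eqVneq k (i + g); last by rewrite mul0r.
by rewrite B0 ?mulr0 // eq_k -addrA.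
Qed.

Lemma M2_component1 (K : fieldType) : 1 \in M2_component K 0.
Proof. by apply/mem_M2_component => i j; rewrite addr0 mxE eq_sym => /negPf ->. Qed.

Lemma M2_component0P (K : fieldType) (A : 'M[K]_2) :
  reflect (A 0 1 = 0 /\ A 1 0 = 0) (A \in M2_component K 0).
Proof.
apply: (iffP (mem_M2_component _ _)) => [A0|[A01 A10]]; first by split; apply: A0.
by case=> [[|[|//]] i] [[|[|//]] j] // _; [rewrite -[RHS]A01|rewrite -[RHS]A10];
  congr (A _ _); apply/val_inj.
Qed.

Lemma M2_component1P (K : fieldType) (A : 'M[K]_2) :
  reflect (A 0 0 = 0 /\ A 1 1 = 0) (A \in M2_component K 1).
Proof.
apply: (iffP (mem_M2_component _ _)) => [A0|[A00 A11]]; first by split; apply: A0.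
by case=> [[|[|//]] i] [[|[|//]] j] // _; [rewrite -[RHS]A00|rewrite -[RHS]A11];
  congr (A _ _); apply/val_inj.
Qed.

Lemma matrix2P (K : fieldType) (A B : 'M[K]_2) :
  A 0 0 = B 0 0 -> A 0 1 = B 0 1 -> A 1 0 = B 1 0 -> A 1 1 = B 1 1 -> A = B.
Proof.
move=> e00 e01 e10 e11; apply/matrixP.
case=> [[|[|//]] i] [[|[|//]] j].
- by move: e00; congr (A _ _ = B _ _); apply/val_inj.
- by move: e01; congr (A _ _ = B _ _); apply/val_inj.
- by move: e10; congr (A _ _ = B _ _); apply/val_inj.
- by move: e11; congr (A _ _ = B _ _); apply/val_inj.
Qed.

(** * Evaluation of graded polynomials *)

Definition graded_point (K : fieldType) : set (gvar -> 'M[K]_2) :=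
  [set a | forall x, a x \in M2_component K (gdeg x)].

Lemma gpoly_evalE (K : fieldType) (a : gvar -> 'M[K]_2) (f : gpoly K) :
  gpoly_eval a f =
    \sum_(m <- msupp f) f@_m *: \prod_(x <- fmonom_val m) a x.
Proof. by rewrite /gpoly_eval mmapE; apply: eq_bigr => m _; rewrite -mul_scalar_mx. Qed.

Lemma gpoly_eval_component (K : fieldType) (g : 'Z_2) (f : gpoly K)
    (a : gvar -> 'M[K]_2) :
    (forall m : {fmonom gvar}, m \in msupp f -> \sum_(x <- fmonom_val m) gdeg x = g) ->
  graded_point a -> gpoly_eval a f \in M2_component K g.
Proof.
move=> f_hom a_graded; rewrite gpoly_evalE big_seq_cond rpred_sum // => m.
rewrite andbT => /f_hom <-; apply: rpredZ.
elim: (fmonom_val m) => [|x s IHs]; first by rewrite !big_nil M2_component1.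
by rewrite !big_cons M2_component_mul.
Qed.

Lemma gpoly_eval_conj (K : fieldType) (f : gpoly K) (a : gvar -> 'M[K]_2)
    (u v : 'M[K]_2) :
    v * u = 1 -> u * v = 1 ->
  gpoly_eval (fun x => u * a x * v) f = u * gpoly_eval a f * v.
Proof.
move=> vu uv; rewrite !gpoly_evalE mulr_sumr mulr_suml; apply: eq_bigr => m _.
rewrite -scalerAr -scalerAl; congr (_ *: _).
elim: (fmonom_val m) => [|x s IHs]; first by rewrite !big_nil mulr1 uv.
by rewrite !big_cons IHs !mulrA -[_ * v * u]mulrA vu mulr1.
Qed.

(** The exponents [w x] may be negative, hence the condition on [c]. *)
Lemma gpoly_eval_weight (K : fieldType) (d : int) (w : gvar -> int) (f : gpoly K)
    (a : gvar -> 'M[K]_2) (c : K) :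
    (forall m : {fmonom gvar}, m \in msupp f ->
       \sum_(x <- undup m) w x * (count_mem x m)%:Z = d) ->
  c != 0 -> gpoly_eval (fun x => c ^ w x *: a x) f = c ^ d *: gpoly_eval a f.
Proof.
move=> f_semi c_neq0; rewrite !gpoly_evalE scaler_sumr !(big_seq_cond xpredT).
apply: eq_bigr => m; rewrite andbT => /f_semi <-; rewrite scalerA mulrC -scalerA.
congr (_ *: _).
have -> : \sum_(x <- undup m) w x * (count_mem x m)%:Z = \sum_(x <- fmonom_val m) w x.
  rewrite -[RHS]big_undup_iterop_count; apply: eq_bigr => x _.
  by rewrite -natz mulr_natr Monoid.iteropE; elim: (count _ _) => //= n <-; rewrite mulrS.
elim: (fmonom_val m) => [|x s IHs]; first by rewrite !big_nil expr0z scale1r.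
by rewrite !big_cons IHs expfzDr // -scalerAl -scalerAr scalerA.
Qed.

Definition segment_point (K : fieldType) (a b : gvar -> 'M[K]_2) (s : K) :=
  fun x => a x + s *: (b x - a x).

Lemma graded_segment (K : fieldType) (a b : gvar -> 'M[K]_2) (s : K) :
  graded_point a -> graded_point b -> graded_point (segment_point a b s).
Proof. by move=> ga gb x; rewrite rpredD ?rpredZ ?rpredB. Qed.

(** Evaluations depend on infinitely many variables; restricting them to lines
replaces polynomial functions on the space of arguments by one-variable
polynomials, to which counting of roots applies. *)
Definition polynomial_on_lines (K : fieldType) (h : (gvar -> 'M[K]_2) -> K) :=
  forall a b, exists r : {poly K}, forall s, h (segment_point a b s) = r.[s].

Lemma polynomial_on_linesM (K : fieldType) (h k : (gvar -> 'M[K]_2) -> K) :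
    polynomial_on_lines h -> polynomial_on_lines k ->
  polynomial_on_lines (fun a => h a * k a).
Proof.
move=> hP kP a b; have [[r hr] [q kq]] := (hP a b, kP a b).
by exists (r * q) => s; rewrite hornerM hr kq.
Qed.

Lemma polynomial_on_linesB (K : fieldType) (h k : (gvar -> 'M[K]_2) -> K) :
    polynomial_on_lines h -> polynomial_on_lines k ->
  polynomial_on_lines (fun a => h a - k a).
Proof.
move=> hP kP a b; have [[r hr] [q kq]] := (hP a b, kP a b).
by exists (r - q) => s; rewrite hornerD hornerN hr kq.
Qed.

Lemma polynomial_on_lines_cst (K : fieldType) (c : K) :
  polynomial_on_lines (fun=> c).
Proof. by move=> a b; exists c%:P => s; rewrite hornerC. Qed.

Lemma gpoly_eval_polynomial (K : fieldType) (f : gpoly K) (i j : 'I_2) :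
  polynomial_on_lines (fun a => gpoly_eval a f i j).
Proof.
move=> a b.
(* Evaluate [f] on the line itself, with the parameter as an indeterminate. *)
pose P : 'M[{poly K}]_2 := \sum_(m <- msupp f) (f@_m)%:P *:
  \prod_(x <- fmonom_val m) (map_mx polyC (a x) + 'X *: map_mx polyC (b x - a x)).
exists (P i j) => s.
have -> : (P i j).[s] = map_mx (horner_eval s) P i j by rewrite mxE.
congr (fun_of_matrix _ i j); rewrite gpoly_evalE /P raddf_sum /=; apply: eq_bigr => m _.
rewrite map_mxZ; congr (_ *: _); first by rewrite /= /horner_eval hornerC.
rewrite rmorph_prod; apply: eq_bigr => x _.
by apply/matrixP => k l; rewrite !mxE /= /horner_eval hornerD hornerM !hornerC hornerX.
Qed.

(** The non-vanishing loci of two nonzero polynomial functions meet: join a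
point of one to a point of the other and restrict both functions to that line. *)
Lemma nonvanishingM (K : fieldType) (char0 : [pchar K] =i pred0)
    (h k : (gvar -> 'M[K]_2) -> K) (a b : gvar -> 'M[K]_2) :
    polynomial_on_lines h -> polynomial_on_lines k ->
    graded_point a -> graded_point b -> h a != 0 -> k b != 0 ->
  exists2 c, graded_point c & h c * k c != 0.
Proof.
move=> hP kP ga gb ha kb; have [[r hr] [q kq]] := (hP a b, kP a b).
have seg0 : segment_point a b 0 = a.
  by apply/funext => x; rewrite /segment_point scale0r addr0.
have seg1 : segment_point a b 1 = b.
  by apply/funext => x; rewrite /segment_point scale1r addrC subrK.
have rq_neq0 : r * q != 0.
  rewrite mulf_neq0 //; apply/eqP => e0.
    by move: ha; rewrite -seg0 hr e0 horner0 eqxx.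
  by move: kb; rewrite -seg1 kq e0 horner0 eqxx.
have [s rqs] := exists_nonroot char0 rq_neq0.
by exists (segment_point a b s); [exact: graded_segment | rewrite hr kq -hornerM].
Qed.

(** Apply [nonvanishingM] repeatedly: the product of the functions is again
polynomial on lines. *)
Lemma common_nonvanishing (K : fieldType) (char0 : [pchar K] =i pred0) (I : eqType)
    (us : seq I) (h : I -> (gvar -> 'M[K]_2) -> K) :
    (forall u, polynomial_on_lines (h u)) ->
    (forall u, u \in us -> exists2 a, graded_point a & h u a != 0) ->
  exists2 a, graded_point a & forall u, u \in us -> h u a != 0.
Proof.
move=> hP nonzero.
suff [a ga ha] : exists2 a, graded_point a & \prod_(u <- us) h u a != 0.
  by exists a => // u u_us; move: ha; rewrite prodf_seq_neq0 => /allP /(_ u u_us).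
elim: us nonzero => [|u us IHus] nonzero.
  exists (fun=> 0); first by move=> x; exact: rpred0.
  by rewrite big_nil oner_neq0.
have [a ga ha] := nonzero u (mem_head u us).
have [|b gb hb] := IHus.
  by move=> v v_us; apply: nonzero; rewrite in_cons v_us orbT.
have prodP : polynomial_on_lines (fun a => \prod_(u <- us) h u a).
  elim: (us) => [|v vs IHvs] a' b'.
    by exists 1 => s; rewrite big_nil hornerC.
  have [r hr] := polynomial_on_linesM (hP v) IHvs a' b'.
  by exists r => s; rewrite big_cons hr.
have [c gc hc] := nonvanishingM char0 (hP u) prodP ga gb ha hb.
by exists c => //; rewrite big_cons.
Qed.

(** * Symmetries of the image *)

Definition mx2 (K : fieldType) (p q r s : K) : 'M[K]_2 :=
  \matrix_(i, j) if i == 0 then (if j == 0 then p else q)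
                 else (if j == 0 then r else s).

Lemma mx2E (K : fieldType) (p q r s : K) :
  (mx2 p q r s 0 0 = p) * (mx2 p q r s 0 1 = q) *
  (mx2 p q r s 1 0 = r) * (mx2 p q r s 1 1 = s).
Proof. by rewrite !mxE. Qed.

Lemma mulmx2E (K : fieldType) (A B : 'M[K]_2) (i j : 'I_2) :
  (A * B) i j = A i 0 * B 0 j + A i 1 * B 1 j.
Proof.
rewrite mxE !big_ord_recl big_ord0 addr0.
by congr (A _ _ * B _ _ + A _ _ * B _ _); apply/val_inj.
Qed.

Lemma gpoly_image0 (K : fieldType) (d : int) (f : gpoly K) :
  d <> 0 -> semi_homogeneous d f -> gpoly_image f 0.
Proof.
move=> d_neq0 [w f_semi]; exists (fun=> 0); first by move=> x; apply: rpred0.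
rewrite gpoly_evalE big_seq_cond big1 // => m; rewrite andbT => /f_semi.
case: (fmonom_val m) => [|x s _]; last by rewrite big_cons mul0r scaler0.
by rewrite /= big_nil => d0; case: d_neq0; rewrite -d0.
Qed.

(** A [d]-th root [y] of [c] provides the substitution [x -> y ^ w x *: x]; for
negative [d], the hypothesis on roots gives the inverse of such a [y]. *)
Lemma gpoly_image_scale (K : fieldType) (d : int) (f : gpoly K) (c : K) (A : 'M[K]_2) :
    d <> 0 -> closed_under_roots K d -> semi_homogeneous d f -> c != 0 ->
  gpoly_image f A -> gpoly_image f (c *: A).
Proof.
move=> d_neq0 rootK [w f_semi] c_neq0 [a ga <-].
have [y y_neq0 yd] : exists2 y : K, y != 0 & y ^ d = c.
  have [z zd] := rootK c.
  have z_neq0 : z != 0.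
    apply/eqP => z0; move: c_neq0; rewrite -zd z0 expr0n absz_eq0.
    by move/eqP: d_neq0 => /negPf ->; rewrite eqxx.
  case: (intP d) zd => [|n|n] zd.
  - by exists z; rewrite // -zd.
  - by exists z; rewrite // -zd.
  - by exists z^-1; rewrite ?invr_eq0 // -zd exprz_inv opprK abszN.
exists (fun x => y ^ w x *: a x); first by move=> x; apply: rpredZ.
by rewrite (gpoly_eval_weight _ f_semi) // yd.
Qed.

(** The degrees of [u] and [v] are opposite, so [x -> u * x * v] maps each
component of the grading to itself. *)
Lemma gpoly_image_conj (K : fieldType) (f : gpoly K) (A u v : 'M[K]_2) (g : 'Z_2) :
    v * u = 1 -> u * v = 1 ->
    u \in M2_component K g -> v \in M2_component K (- g) ->
  gpoly_image f A -> gpoly_image f (u * A * v).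
Proof.
move=> vu uv gu gv [a ga <-]; exists (fun x => u * a x * v).
  by move=> x; rewrite -[gdeg x](addrK g) [gdeg x + g]addrC !M2_component_mul.
exact: gpoly_eval_conj.
Qed.

(** Conjugation by the permutation matrix, which is odd and its own inverse. *)
Lemma gpoly_image_swap (K : fieldType) (f : gpoly K) (A : 'M[K]_2) :
  gpoly_image f A -> gpoly_image f (mx2 (A 1 1) (A 1 0) (A 0 1) (A 0 0)).
Proof.
pose J := mx2 0 1 1 0 : 'M[K]_2.
have JJ : J * J = 1 by apply: matrix2P; rewrite mulmx2E !mx2E mxE /=; ring.
have gJ : J \in M2_component K 1 by apply/M2_component1P; rewrite !mx2E.
have -> : mx2 (A 1 1) (A 1 0) (A 0 1) (A 0 0) = J * A * J.
  by apply: matrix2P; rewrite !mulmx2E !mx2E; ring.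
exact: (gpoly_image_conj (g := 1)).
Qed.

(** Conjugation by [diag(c, 1)]. *)
Lemma gpoly_image_torus (K : fieldType) (f : gpoly K) (A : 'M[K]_2) (c : K) :
    c != 0 -> gpoly_image f A ->
  gpoly_image f (mx2 (A 0 0) (c * A 0 1) (c^-1 * A 1 0) (A 1 1)).
Proof.
move=> c_neq0; pose D (x : K) := mx2 x 0 0 1 : 'M[K]_2.
have DM x y : x * y = 1 -> D x * D y = 1.
  by move=> xy; apply: matrix2P; rewrite mulmx2E !mx2E mxE ?xy /=; ring.
have gD x : D x \in M2_component K 0 by apply/M2_component0P; rewrite !mx2E.
have -> : mx2 (A 0 0) (c * A 0 1) (c^-1 * A 1 0) (A 1 1) = D c * A * D c^-1.
  by apply: matrix2P; rewrite !mulmx2E !mx2E; field.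
by apply: (gpoly_image_conj (g := 0)); rewrite ?oppr0 ?DM ?mulfV ?mulVf.
Qed.

(** * The image of an odd polynomial *)

Lemma sqrt_exists (K : fieldType) (x : K) :
  quadratically_closed K -> exists c, c ^+ 2 = x.
Proof.
move=> qcK; have [|c] := qcK ('X^2 - x%:P); first by rewrite size_XnsubC.
by rewrite /root !hornerE subr_eq0 => /eqP; exists c.
Qed.

(** The torus of diagonal matrices and the scalars act on the two off-diagonal
entries by [(p, q) -> (c p, q / c)] and [(p, q) -> (l p, l q)]. When square
roots exist, the orbit of a point with [p q <> 0] is all of [p q <> 0]. *)
Lemma odd_image (K : fieldType) (char0 : [pchar K] =i pred0)
    (qcK : quadratically_closed K) (d : int) (f : gpoly K) :
    d <> 0 -> closed_under_roots K d -> semi_homogeneous d f ->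
    gpoly_image f `<=` [set` M2_component K 1] ->
  gpoly_image f = [set 0] \/ zariski_dense (M2_component K 1) (gpoly_image f).
Proof.
move=> d_neq0 rootK f_semi f_odd.
have [all0|/existsNP[A /not_implyP[fA A_neq0]]] :=
  EM (forall A, gpoly_image f A -> A = 0).
  left; apply/seteqP; split=> [A /all0 //|_ ->]; exact: gpoly_image0 f_semi.
right.
have [P fP P01] : exists2 P, gpoly_image f P & P 0 1 != 0.
  have [A00 A11] := M2_component1P _ (f_odd _ fA).
  have [A01|] := eqVneq (A 0 1) 0; last by exists A.
  exists (mx2 (A 1 1) (A 1 0) (A 0 1) (A 0 0)); first exact: gpoly_image_swap.
  rewrite mx2E; apply/eqP => A10; apply: A_neq0.
  by apply: matrix2P; rewrite mxE.
have [b [gb fb]] : exists b, graded_point b /\ gpoly_eval b f 0 1 * gpoly_eval b f 1 0 != 0.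
  case: (fP) => a ga aP.
  case: (gpoly_image_swap fP) => a' ga' aP'.
  have [||b gb fb] := nonvanishingM char0 (gpoly_eval_polynomial f 0 1)
    (gpoly_eval_polynomial f 1 0) ga ga'; first by rewrite aP.
    by rewrite aP' mx2E.
  by exists b.
move: fb; set B := gpoly_eval b f; rewrite mulf_eq0 negb_or => /andP[B01 B10].
have fB : gpoly_image f B by exists b.
have [B00 B11] := M2_component1P _ (f_odd _ fB).
have all_units x y : x != 0 -> y != 0 -> gpoly_image f (mx2 0 x y 0).
  (* The scalar [x / (c B01)] corrects the first entry; [c] is chosen so that
     the second entry, [x B10 / (c ^+ 2 B01)], is then [y]. *)
  move=> x_neq0 y_neq0; have [c c2] := sqrt_exists (x * B 1 0 / (B 0 1 * y)) qcK.
  have c_neq0 : c != 0 by rewrite -sqrf_eq0 c2; do !rewrite ?invr_eq0 mulf_neq0.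
  have -> : mx2 0 x y 0 = (x / (c * B 0 1)) *:
      mx2 (B 0 0) (c * B 0 1) (c^-1 * B 1 0) (B 1 1).
    apply: matrix2P; rewrite [RHS]mxE !mx2E ?B00 ?B11 ?mulr0 //.
      by field; rewrite c_neq0 B01.
    have -> : x / (c * B 0 1) * (c^-1 * B 1 0) = x * B 1 0 / (B 0 1 * c ^+ 2).
      by field; rewrite c_neq0 B01.
    by rewrite c2; field; rewrite B01 B10 x_neq0 y_neq0.
  apply: (gpoly_image_scale d_neq0 rootK f_semi).
    by rewrite mulf_neq0 ?invr_eq0 ?mulf_neq0.
  exact: gpoly_image_torus.
apply: zariski_dense_of_lines => // v /M2_component1P[v00 v11].
(* Along [(1, 1)], at most two points of the line have a zero entry. *)
exists (mx2 0 1 1 0) => cs.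
have [t] := exists_notin char0 (- v 0 1 :: - v 1 0 :: cs).
rewrite !inE !negb_or -!addr_eq0 => /and3P[t0 t1 tcs]; exists t => //.
have -> : v + t *: mx2 0 1 1 0 = mx2 0 (t + v 0 1) (t + v 1 0) 0.
  by apply: matrix2P; rewrite mxE [X in _ + X]mxE !mx2E ?v00 ?v11; ring.
exact: all_units.
Qed.

(** * The image of an even polynomial *)

Definition diag_det (K : fieldType) (A B : 'M[K]_2) : K :=
  A 0 0 * B 1 1 - A 1 1 * B 0 0.

Lemma diag_det_polynomial (K : fieldType) (f : gpoly K) (u : 'M[K]_2) :
  polynomial_on_lines (fun a => diag_det u (gpoly_eval a f)).
Proof.
by apply: polynomial_on_linesB; apply: polynomial_on_linesM;
  (exact: polynomial_on_lines_cst || exact: gpoly_eval_polynomial).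
Qed.

(** Given [v] nonzero, take [w] independent of it. For a value [A] of [f], the line
[v + t w] meets the line spanned by [A] at [t = - det(v, A) / det(w, A)], by
Cramer's rule. This parameter is defined and differs from [c] exactly when [A]
is not proportional to [w] nor to [v + c w]. Finitely many such conditions hold
at once for some argument of [f], each being a nonzero polynomial condition
because [X] and [Y] are not both proportional to a given nonzero vector. *)
Lemma even_image_dense (K : fieldType) (char0 : [pchar K] =i pred0)
    (d : int) (f : gpoly K) (X Y : 'M[K]_2) :
    d <> 0 -> closed_under_roots K d -> semi_homogeneous d f ->
    gpoly_image f `<=` [set` M2_component K 0] ->
    gpoly_image f X -> gpoly_image f Y -> diag_det X Y != 0 ->
  zariski_dense (M2_component K 0) (gpoly_image f).
Proof.
move=> d_neq0 rootK f_semi f_even fX fY XY.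
apply: zariski_dense_of_lines => // v v_even.
have [v01 v10] := M2_component0P _ v_even.
have [->|v_neq0] := eqVneq v 0.
  exists 0 => cs; have [t tcs] := exists_notin char0 cs; exists t => //.
  by rewrite scaler0 addr0; exact: gpoly_image0 f_semi.
have [w w_even vw] : exists2 w, w \in M2_component K 0 & diag_det v w != 0.
  have [v00|v00] := eqVneq (v 0 0) 0.
    exists (mx2 1 0 0 0); first by apply/M2_component0P; rewrite !mx2E.
    rewrite /diag_det !mx2E mulr0 mulr1 sub0r oppr_eq0.
    by apply: contra v_neq0 => /eqP v11; apply/eqP/matrix2P; rewrite mxE.
  exists (mx2 0 0 0 1); first by apply/M2_component0P; rewrite !mx2E.
  by rewrite /diag_det !mx2E mulr0 mulr1 subr0.
have [w01 w10] := M2_component0P _ w_even.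
exists w => cs.
have [|u u_us|a ga a_us] := @common_nonvanishing K char0 _
    (w :: [seq v + c *: w | c <- cs]) (fun u a => diag_det u (gpoly_eval a f)).
- exact: diag_det_polynomial.
- have [z uz] : exists z, diag_det u z != 0.
    move: u_us; rewrite inE => /predU1P[->|/mapP[c _ ->]].
      by exists v; rewrite -oppr_eq0 opprB mulrC [w 0 0 * _]mulrC.
    exists w; rewrite /diag_det !mxE; apply: contra vw => /eqP <-.
    by apply/eqP; rewrite /diag_det; ring.
  case: (fX) (fY) => [x gx xX] [y gy yY].
  have [uX|uX] := eqVneq (diag_det u X) 0; last by exists x; rewrite ?xX.
  exists y; rewrite ?yY //; apply/eqP => uY.
  (* The Pluecker relation for four vectors of the plane. *)
  have : diag_det u z * diag_det X Y =
      diag_det u X * diag_det z Y - diag_det u Y * diag_det z X.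
    by rewrite /diag_det; ring.
  by move/eqP; rewrite uX uY !mul0r subrr mulf_eq0 (negPf uz) (negPf XY).
set A := gpoly_eval a f in a_us.
have fA : gpoly_image f A by exists a.
have [A01 A10] := M2_component0P _ (f_even _ fA).
have wA : diag_det w A != 0 := a_us w (mem_head _ _).
exists (- diag_det v A / diag_det w A).
  apply/negP => t_cs.
  have := a_us _ (mem_behead (s := _ :: _) (map_f (fun c => v + c *: w) t_cs)).
  by rewrite {1}/diag_det !mxE => /eqP; apply; rewrite /diag_det; field.
have -> : v + (- diag_det v A / diag_det w A) *: w =
    (- diag_det v w / diag_det w A) *: A.
  by apply: matrix2P; rewrite !mxE ?v01 ?v10 ?w01 ?w10 ?A01 ?A10;
    rewrite /diag_det; field.
by apply: (gpoly_image_scale d_neq0 rootK f_semi) => //;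
  rewrite mulf_neq0 ?oppr_eq0 ?invr_eq0.
Qed.

(** When all values are proportional, apply this to a value [(p, q)] and its swap
[(q, p)]: then [p ^+ 2 = q ^+ 2], so the line of values is spanned by [(1, 1)]
or by [(1, -1)]. *)
Lemma even_image (K : fieldType) (char0 : [pchar K] =i pred0)
    (d : int) (f : gpoly K) :
    d <> 0 -> closed_under_roots K d -> semi_homogeneous d f ->
    gpoly_image f `<=` [set` M2_component K 0] ->
  [\/ gpoly_image f = [set 0],
      gpoly_image f = [set c%:M | c in [set: K]],
      gpoly_image f = [set A | A \in M2_component K 0 /\ \tr A = 0]
    | zariski_dense (M2_component K 0) (gpoly_image f)].
Proof.
move=> d_neq0 rootK f_semi f_even.
have [all0|/existsNP[A /not_implyP[fA A_neq0]]] :=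
  EM (forall A, gpoly_image f A -> A = 0).
  constructor 1; apply/seteqP; split=> [A /all0 //|_ ->]; exact: gpoly_image0 f_semi.
have [[X [Y [fX fY XY]]]|dep] :=
    EM (exists X Y, [/\ gpoly_image f X, gpoly_image f Y & diag_det X Y != 0]).
  constructor 4.
  exact: (even_image_dense char0 d_neq0 rootK f_semi f_even fX fY XY).
have {}dep X Y : gpoly_image f X -> gpoly_image f Y -> diag_det X Y = 0.
  by move=> fX fY; apply/eqP/negPn/negP => XY; apply: dep; exists X, Y.
have scale c B : gpoly_image f B -> gpoly_image f (c *: B).
  have [->|c_neq0] := eqVneq c 0; last exact: (gpoly_image_scale d_neq0 rootK f_semi).
  by rewrite scale0r => _; exact: gpoly_image0 f_semi.
have [A01 A10] := M2_component0P _ (f_even _ fA).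
have trmx2 (B : 'M[K]_2) : \tr B = B 0 0 + B 1 1.
  rewrite /mxtrace !big_ord_recl big_ord0 addr0.
  by congr (fun_of_matrix B _ _ + fun_of_matrix B _ _); apply/val_inj.
have : A 0 0 ^+ 2 = A 1 1 ^+ 2.
  apply/eqP; rewrite -subr_eq0 !expr2.
  by have := dep _ _ fA (gpoly_image_swap fA); rewrite /diag_det !mx2E => ->.
move/eqP; rewrite eqf_sqr => /orP[] /eqP eA.
- have A11 : A 1 1 != 0.
    by apply/eqP => A11; apply: A_neq0; apply: matrix2P; rewrite mxE // eA.
  constructor 2; apply/seteqP; split=> [B fB|_ [c _ <-]].
    have [B01 B10] := M2_component0P _ (f_even _ fB).
    exists (B 1 1) => //; apply: matrix2P; rewrite mxE //= ?mulr1n //.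
    have := dep _ _ fA fB; rewrite /diag_det eA -mulrBr => /eqP.
    by rewrite mulf_eq0 (negPf A11) subr_eq0 => /eqP.
  suff -> : c%:M = (c / A 1 1) *: A by apply: scale.
  by apply: matrix2P; rewrite !mxE /= ?A01 ?A10 ?eA ?mulr0 // divfK.
- have A11 : A 1 1 != 0.
    by apply/eqP => A11; apply: A_neq0; apply: matrix2P; rewrite mxE // eA A11 oppr0.
  constructor 3; apply/seteqP; split=> [B fB|B [B_even trB]].
    split; first exact: f_even.
    rewrite trmx2; have := dep _ _ fA fB; rewrite /diag_det eA mulNr -opprD -mulrDr.
    move/eqP; rewrite oppr_eq0 mulf_eq0 (negPf A11) addrC => /eqP //.
  have [B01 B10] := M2_component0P _ B_even.
  have B00 : B 0 0 = - B 1 1 by apply/eqP; rewrite -addr_eq0 -trmx2 trB.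
  suff -> : B = (B 1 1 / A 1 1) *: A by apply: scale.
  by apply: matrix2P; rewrite !mxE /= ?A01 ?A10 ?B01 ?B10 ?eA ?B00 ?mulr0 ?mulrN // divfK.
Qed.

Theorem theorem22 (K : fieldType) (char0 : [pchar K] =i pred0)
    (qcK : quadratically_closed K) (d : int) (d_neq0 : d <> 0)
    (rootK : closed_under_roots K d) (f : gpoly K)
    (f_hom : graded_homogeneous f) (f_semi : semi_homogeneous d f) :
  gpoly_image f = [set 0]
  \/ gpoly_image f = [set c%:M | c in [set: K]]
  \/ gpoly_image f = [set A | A \in M2_component K 0 /\ \tr A = 0]
  \/ gpoly_image f = [set` M2_component K 0]
  \/ gpoly_image f = [set` M2_component K 1]
  \/ zariski_dense (M2_component K 0) (gpoly_image f)
  \/ zariski_dense (M2_component K 1) (gpoly_image f).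
Proof.
have [g f_g] := f_hom.
have f_comp : gpoly_image f `<=` [set` M2_component K g].
  by move=> _ [a ga <-]; apply: gpoly_eval_component.
have [g0|g1] : g = 0 \/ g = 1.
  by case: (g) => [[|[|//]] ?]; [left|right]; apply/val_inj.
- rewrite {}g0 in f_comp.
  have [|||] := even_image char0 d_neq0 rootK f_semi f_comp; first by left.
  + by right; left.
  + by right; right; left.
  + by do 5!right; left.
- rewrite {}g1 in f_comp.
  have [|] := odd_image char0 qcK d_neq0 rootK f_semi f_comp; first by left.
  by do 6!right.
Qed.
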